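(* Let $s,t$ be two integers and let $k$ be a positive integer. Let $F_1$ be a graph of order $s$, and suppose there is an integer $a\geq 1$ and graphs $F_1,F_2,\ldots,F_a$ such that for each $2\leq i\leq a$ the graph $F_i$ is obtained from $F_{i-1}$ by deleting all leaves of $F_{i-1}$, and such that $F_a$ has no leaves. Let $r$ be the total number of edges deleted in passing from $F_1$ to $F_a$. If $\Delta(F_a)=d\geq 2$, $e(F_1)=b$ and $b\leq 2d^2(s-r)+32d^4$, then $$\operatorname{gr}_k(F_1,K_t)\leq (2d^2(s-r)+32d^4)^{kt}+4(s-r)\,\frac{(2d^2(s-r)+32d^4)^{kt}-1}{2d^2(s-r)+32d^4-1}.$$
   Context: The order of a graph is its number of vertices; $e(F)$ denotes the number of edges and $\Delta(F)$ the maximum degree of $F$; a leaf is a vertex of degree one. A $k$-edge-coloring of $K_n$ assigns to each edge one of $k$ colors (not all colors need be used, and it need not be proper). A subgraph is rainbow if all its edges have distinct colors, and monochromatic if all its edges have the same color. For graphs $G,H$ and a positive integer $k$, the Gallai-Ramsey number $\operatorname{gr}_k(G,H)$ is the minimum integer $n$ such that every $k$-edge-coloring of the complete graph $K_n$ contains a rainbow copy of $G$ or a monochromatic copy of $H$. *)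

(* Defs.v *)
From mathcomp Require Import all_boot.

Set Implicit Arguments.
Unset Strict Implicit.
Unset Printing Implicit Defensive.

Record sgraph := SGraph {
  vertex :> finType;
  adj : rel vertex;
  adj_sym : symmetric adj;
  adj_irr : irreflexive adj
}.

Definition graph_order (G : sgraph) : nat := #|G|.

Definition edges (G : sgraph) : {set {set G}} :=
  [set e | [exists x : G, exists y : G, adj x y && (e == [set x; y])]].

Definition num_edges (G : sgraph) : nat := #|edges G|.

Definition vdegree (G : sgraph) (x : G) : nat := #|[set y | adj x y]|.

Definition max_degree (G : sgraph) : nat := \max_(x : G) vdegree x.

Definition leaf (G : sgraph) (x : G) : bool := vdegree x == 1.

Section Induced.
Variables (G : sgraph) (A : {set G}).

Definition induced_adj : rel {x : G | x \in A} :=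
  fun x y => adj (val x) (val y).

Lemma induced_sym : symmetric induced_adj.
Proof. by move=> x y; apply: adj_sym. Qed.

Lemma induced_irr : irreflexive induced_adj.
Proof. by move=> x; apply: adj_irr. Qed.

Definition induced : sgraph := SGraph induced_sym induced_irr.
End Induced.

(* All leaves are removed simultaneously: an isolated edge loses both of its
   endpoints, while a vertex that only becomes a leaf is kept. *)
Definition delete_leaves (G : sgraph) : sgraph :=
  induced [set x : G | ~~ leaf x].

(* The edges lost in passing from G to delete_leaves G. *)
Definition deleted_edges (G : sgraph) : {set {set G}} :=
  [set e in edges G | [exists x in e, leaf x]].

Definition isomorphic (G H : sgraph) : Prop :=
  exists f : G -> H, bijective f /\ forall x y, adj (f x) (f y) = adj x y.

Section Complete.
Variable n : nat.

Definition complete_adj : rel 'I_n := fun x y => x != y.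

Lemma complete_sym : symmetric complete_adj.
Proof. by move=> x y; rewrite /complete_adj eq_sym. Qed.

Lemma complete_irr : irreflexive complete_adj.
Proof. by move=> x; rewrite /complete_adj eqxx. Qed.

Definition complete : sgraph := SGraph complete_sym complete_irr.
End Complete.

(* An edge-coloring of complete n is a function on all subsets of its vertices;
   only its values on two-element sets are ever used. *)
Definition coloring (n k : nat) : Type := {set complete n} -> 'I_k.

(* Any injective map of vertices into a complete graph maps edges to edges, so
   it determines a copy, whose edges are the images f @: e. *)
Definition has_rainbow_copy (n k : nat) (c : coloring n k) (G : sgraph) : Prop :=
  exists f : G -> complete n,
    injective f /\ {in edges G &, injective (fun e : {set G} => c (f @: e))}.

Definition has_mono_copy (n k : nat) (c : coloring n k) (H : sgraph) : Prop :=
  exists f : H -> complete n,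
    injective f /\ {in edges H &, forall e e' : {set H}, c (f @: e) = c (f @: e')}.

Definition gallai_ramsey_prop (k : nat) (G H : sgraph) (n : nat) : Prop :=
  forall c : coloring n k, has_rainbow_copy c G \/ has_mono_copy c H.

(* n = gr_k(G, H) *)
Definition is_gallai_ramsey (k : nat) (G H : sgraph) (n : nat) : Prop :=
  gallai_ramsey_prop k G H n /\
  forall m, gallai_ramsey_prop k G H m -> n <= m.

(* Main.v *)
(* Put m = s - r and N = 2 d^2 m + 32 d^4, and let f(0) = 1 and
   f(q + 1) = N f(q) + 4 m, so that the claimed bound is f(kt).  By induction on
   q = t_1 + ... + t_k, a coloring of f(q) vertices contains a rainbow F_1 or a
   clique of order t_i in color i for some i.  If some vertex has at least
   f(q - 1) neighbors in one color i, recurse into them with t_i - 1.  Otherwise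
   every color has maximum degree at most D = f(q - 1) - 1, and F_1 embeds
   greedily as a rainbow subgraph of the n >= N (D + 1) + 4 m vertices: first
   F_a, then the deleted leaves.

   A leaf is blocked only by used vertices and by at most b D vertices joined
   to the image of its neighbor in a used color.  For F_a, the danger is that
   two neighbors of the new vertex are sent to x, y with c(xw) = c(yw) for most
   w.  For fixed x the number of such pairs (y, w) is at most n D, so at most
   2 d^2 D vertices y have more than n / (2 d^2) of them; avoiding such y
   whenever two vertices of F_a have a common neighbor, fewer than n vertices
   are blocked at each step. *)
Require Import Defs.
From mathcomp Require Import all_boot all_order all_algebra zify ring.
From Stdlib Require Import Classical.

Set Implicit Arguments.
Unset Strict Implicit.
Unset Printing Implicit Defensive.

(** * Union bounds, edges and degree sums *)

Lemma card_bigcup_le (I T : finType) (P : {set I}) (A : I -> {set T}) :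
  #|\bigcup_(i in P) A i| <= \sum_(i in P) #|A i|.
Proof.
elim/big_rec2: _ => [|i m B _ le_Bm]; first by rewrite cards0.
by apply: leq_trans (leq_card_setU _ _) _; rewrite leq_add2l.
Qed.

(** The factor [k] allows each set to be bounded by the fraction [M / k] without dividing. *)
Lemma card_bigcup_bound (I T : finType) (P : {set I}) (A : I -> {set T}) k d M :
  #|P| <= d -> {in P, forall i, k * #|A i| <= M} ->
  k * #|\bigcup_(i in P) A i| <= d * M.
Proof.
move=> leP leA; apply: leq_trans (_ : k * \sum_(i in P) #|A i| <= _).
  by rewrite leq_mul2l card_bigcup_le orbT.
rewrite big_distrr; apply: leq_trans (_ : \sum_(i in P) M <= _).
  exact: leq_sum.
by rewrite sum_nat_const leq_mul2r leP orbT.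
Qed.

Lemma edgesP (G : sgraph) (e : {set G}) :
  reflect (exists x y, adj x y /\ e = [set x; y]) (e \in edges G).
Proof.
rewrite inE; apply: (iffP existsP) => [[x /existsP[y /andP[xy /eqP->]]]|].
  by exists x, y.
by case=> x [y [xy ->]]; exists x; apply/existsP; exists y; rewrite xy eqxx.
Qed.

Lemma adj_neq (G : sgraph) (x y : G) : adj x y -> x != y.
Proof. by apply: contraTneq => ->; rewrite adj_irr. Qed.

Lemma adj_edges (G : sgraph) (x y : G) : adj x y -> [set x; y] \in edges G.
Proof. by move=> xy; apply/edgesP; exists x, y. Qed.

(** Incident pairs are counted twice: an edge has two ends, and the edges at [x] are images of its
    neighbors [y] under [[set x; y]]. *)
Lemma handshake (G : sgraph) : (num_edges G).*2 <= \sum_(x : G) vdegree x.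
Proof.
have -> : (num_edges G).*2 = \sum_(e in edges G) \sum_(x in e) 1.
  rewrite -muln2 -sum_nat_const; apply: eq_bigr => e /edgesP[x [y [xy ->]]].
  by rewrite sum1_card cards2 (adj_neq xy).
rewrite (exchange_big_dep predT) //=; apply: leq_sum => x _.
rewrite sum1dep_card /vdegree.
apply: leq_trans (leq_imset_card (fun y => [set x; y]) _).
apply/subset_leq_card/subsetP => e; rewrite inE => /andP[/edgesP[y [z [yz ->]]]].
rewrite !inE => /orP[] /eqP->; apply/imsetP; [exists z|exists y] => //.
- by rewrite inE.
- by rewrite inE adj_sym.
- by rewrite setUC.
Qed.

Lemma num_edges_degree_bound (G : sgraph) (d m : nat) :
  (forall x : G, vdegree x <= d) -> #|G| <= m -> 2 * num_edges G <= d * m.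
Proof.
move=> dG mG; rewrite mul2n; apply: leq_trans (handshake G) _.
apply: leq_trans (_ : \sum_(x : G) d <= _); first by apply: leq_sum.
by rewrite sum_nat_const mulnC leq_mul2l mG orbT.
Qed.

Lemma sum_card_mem (T : finType) (A B : {set T}) (p : T -> T -> bool) :
  \sum_(x in A) #|[set y in B | p x y]| =
  \sum_(x in A) \sum_(y in B) (p x y : nat).
Proof.
apply: eq_bigr => x _; rewrite -sum1dep_card big_mkcondr /=.
by apply: eq_bigr => y _; case: (p x y).
Qed.

(** * Partial rainbow embeddings and their greedy extension *)

Section Rainbow.
Variables (T C : finType) (c : {set T} -> C).

Section OnGraph.
Variable G : sgraph.
Implicit Types (S : {set G}) (f : G -> T).

Definition edges_in S : {set {set G}} := [set e in edges G | e \subset S].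

(** A partial embedding is a total map [f] with a domain [S]; its values outside [S] are
    arbitrary. *)
Definition rainbow_on S f : Prop :=
  {in S &, injective f} /\ {in edges_in S &, injective (fun e : {set G} => c (f @: e))}.

Definition used_colors S f : {set C} := [set c (f @: (e : {set G})) | e in edges_in S].

Lemma edges_inP S (e : {set G}) :
  reflect (exists x y, [/\ adj x y, x \in S, y \in S & e = [set x; y]])
          (e \in edges_in S).
Proof.
rewrite inE; apply: (iffP andP) => [[/edgesP[x [y [xy ->]]]]|].
  by rewrite subUset !sub1set => /andP[xS yS]; exists x, y.
case=> x [y [xy xS yS ->]]; rewrite adj_edges //.
by rewrite subUset !sub1set xS yS.
Qed.

Lemma card_used_colors S f : #|used_colors S f| <= num_edges G.
Proof.
apply: leq_trans (leq_imset_card _ _) _.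
by apply/subset_leq_card/subsetP => e; rewrite inE => /andP[].
Qed.

Lemma edges_in_setU1 S (v : G) (e : {set G}) :
  e \in edges_in (v |: S) ->
  e \in edges_in S \/ exists u, [/\ u \in S, adj u v & e = [set u; v]].
Proof.
case/edges_inP=> x [y [xy xS yS ->]].
have [xv|xv] := eqVneq x v; last have [yv|yv] := eqVneq y v.
- right; exists y; rewrite adj_sym -xv xy setUC; split=> //.
  by move: yS; rewrite -xv in_setU1 eq_sym (negPf (adj_neq xy)).
- right; exists x; rewrite -yv xy; split=> //.
  by move: xS; rewrite in_setU1 (negPf xv).
- left; apply/edges_inP; exists x, y; split=> //.
    by move: xS; rewrite in_setU1 (negPf xv).
  by move: yS; rewrite in_setU1 (negPf yv).
Qed.

(** The new edges join [v] to its neighbors in [S]. The two color premises exclude a clash of a new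
    edge with an old one, and of two new edges. *)
Lemma rainbow_on_setU1 S f (v : G) (w : T) :
  rainbow_on S f -> v \notin S -> w \notin f @: S ->
  {in S, forall u, adj u v -> c [set f u; w] \notin used_colors S f} ->
  {in S &, forall u u', adj u v -> adj u' v ->
     c [set f u; w] = c [set f u'; w] -> u = u'} ->
  rainbow_on (v |: S) (fun x => if x == v then w else f x).
Proof.
move=> [injf rbf] vS wS newc distc; set g := fun x => _.
have gS x : x \in S -> g x = f x.
  by move=> xS; rewrite /g; case: eqP => // xv; rewrite -xv xS in vS.
have gv : g v = w by rewrite /g eqxx.
have ge e : e \in edges_in S -> g @: e = f @: e.
  rewrite inE => /andP[_ /subsetP eS]; apply: eq_in_imset => x xe.
  by rewrite gS ?eS.
have ge1 u : u \in S -> g @: [set u; v] = [set f u; w].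
  by move=> uS; rewrite imsetU1 imset_set1 gS ?gv.
split=> [x y|e e'].
  rewrite !in_setU1 => /orP[/eqP->|xS] /orP[/eqP->|yS] //.
  - by rewrite gv gS // => wy; rewrite wy imset_f in wS.
  - by rewrite gv gS // => wx; rewrite -wx imset_f in wS.
  - by rewrite !gS //; apply: injf.
case/edges_in_setU1=> [eS|[u [uS uv ->]]]; case/edges_in_setU1=> [eS'|[u' [uS' uv' ->]]] /=.
- by rewrite !ge //; apply: rbf.
- rewrite ge // ge1 // => ce; case/negP: (newc _ uS' uv').
  by rewrite -ce; apply: (imset_f (fun e : {set G} => c (f @: e))).
- rewrite ge1 // ge // => ce; case/negP: (newc _ uS uv).
  by rewrite ce; apply: (imset_f (fun e : {set G} => c (f @: e))).
- by rewrite !ge1 // => /(distc _ _ uS uS' uv uv') ->.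
Qed.

Definition rainbow_in (U : {set T}) : Prop :=
  exists2 f : G -> T, rainbow_on [set: G] f & forall x, f x \in U.

(** Induction on the number of vertices outside [S0]. Each step may use [S0 \subset S]; when [S0] is
    the set of non-leaves, this says that the new vertex is a leaf. *)
Lemma greedy_extension (P : {set G} -> (G -> T) -> Prop) (S0 : {set G}) f0 :
  P S0 f0 ->
  (forall S f v, S0 \subset S -> v \notin S -> P S f ->
     exists w, P (v |: S) (fun x => if x == v then w else f x)) ->
  exists f, P [set: G] f.
Proof.
move=> P0 step.
have [k] := ubnP #|~: S0|; elim: k S0 f0 P0 step => // k IHk S0 f0 P0 step.
rewrite ltnS => leS0; have [S0T|[v]] := set_0Vmem (~: S0).
  by exists f0; rewrite -[setT]setC0 -S0T setCK.
rewrite inE => vS; have [w Pw] := step _ _ v (subxx _) vS P0.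
apply: IHk Pw _ _ => [S f u /(subset_trans (subsetUr _ _)) sub|].
  exact: step.
by apply: leq_trans leS0; rewrite setCU setIC -setDE [X in _ < X](cardsD1 v) inE vS.
Qed.

End OnGraph.

(** Transports embeddings along the isomorphisms of the deletion chain. *)
Lemma rainbow_in_hom (G H : sgraph) (U : {set T}) (h : G -> H) :
  injective h -> (forall x y, adj x y -> adj (h x) (h y)) ->
  rainbow_in H U -> rainbow_in G U.
Proof.
move=> injh homh [f [injf rbf] fU]; exists (f \o h); last by move=> x; apply: fU.
split.
  by move=> x y _ _ fxy; apply/injh/injf.
have hE e : e \in edges_in [set: G] -> h @: e \in edges_in [set: H].
  case/edges_inP=> x [y [xy _ _ ->]]; apply/edges_inP; exists (h x), (h y).
  by rewrite homh // !in_setT imsetU1 imset_set1.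
move=> e e' eE eE' /=; rewrite [X in c X]imset_comp [X in _ = c X]imset_comp => ce.
apply: (imset_inj injh); apply: rbf; [exact: hE|exact: hE|exact: ce].
Qed.

End Rainbow.

Lemma exists_notin (T : finType) (U A : {set T}) :
  #|A| < #|U| -> exists2 w, w \in U & w \notin A.
Proof.
move=> ltAU; have /subsetPn[w wU wA] : ~~ (U \subset A).
  by apply: contraL ltAU => /subset_leq_card; rewrite leqNgt.
by exists w.
Qed.

(** * Bounded color degrees: putting the leaves back *)

Section LocallyBounded.
Variables (T C : finType) (c : {set T} -> C) (U : {set T}) (D : nat).

(** The clause [y != x] discards the value that [c] takes on a singleton. *)
Definition color_nbhd (x : T) (i : C) : {set T} :=
  [set y in U | (y != x) && (c [set x; y] == i)].

Hypothesis U_gt0 : 0 < #|U|.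
Hypothesis bounded : forall x i, x \in U -> #|color_nbhd x i| <= D.

Lemma card_bigcup_color_nbhd (G : sgraph) (S : {set G}) (f : G -> T) x :
  x \in U ->
  #|\bigcup_(i in used_colors c S f) color_nbhd x i| <= num_edges G * D.
Proof.
move=> xU; rewrite -[#|_|]mul1n; apply: card_bigcup_bound => [|i _].
  exact: card_used_colors.
by rewrite mul1n bounded.
Qed.

Lemma used_colorsPn (G : sgraph) (S : {set G}) (f : G -> T) x w :
  w \in U -> w != x ->
  w \notin \bigcup_(i in used_colors c S f) color_nbhd x i ->
  c [set x; w] \notin used_colors c S f.
Proof.
move=> wU wx; apply: contra => cS.
by apply/bigcupP; exists (c [set x; w]); rewrite // inE wU wx eqxx.
Qed.

(** A restored leaf brings at most one new edge. Its image must avoid fewer than [#|G|] used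
    vertices and at most [num_edges G * D] vertices that would repeat a used color. *)
Lemma rainbow_delete_leaves (G : sgraph) :
  #|G| + num_edges G * D <= #|U| ->
  rainbow_in c (delete_leaves G) U -> rainbow_in c G U.
Proof.
move=> leU [f0 [injf0 rbf0] f0U].
have [x0 x0U] : exists x0, x0 \in U by apply/card_gt0P.
pose S0 := [set x : G | ~~ leaf x].
pose f (x : G) := oapp f0 x0 (insub x : option (delete_leaves G)).
have fval (x : delete_leaves G) : f (val x) = f0 x by rewrite /f valK.
have fvale (e : {set delete_leaves G}) : f @: (val @: e) = f0 @: e.
  by rewrite -imset_comp; apply: eq_imset => x; apply: fval.
have lift (x : G) : x \in S0 -> {y : delete_leaves G | x = val y}.
  by move=> xS; exists (Sub x xS); rewrite SubK.
(* Values lie in [U] even outside [S]: the neighbor [u0] of a leaf may be a leaf not yet placed, and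
   [bounded] is still applied at its image. *)
pose P S (f : G -> T) := rainbow_on c S f /\ forall x, f x \in U.
suff [g [rbg gU]] : exists f, P [set: G] f by exists g.
apply: (greedy_extension (S0 := S0) (f0 := f)) => [|S g v S0S vS [rbg gU]].
  split; last by move=> x; rewrite /f; case: insubP => //= y _ _; apply: f0U.
  split=> [x y /lift[x' ->] /lift[y' ->]|].
    by rewrite !fval => /injf0->.
  have lifte (e : {set G}) : e \in edges_in S0 ->
      exists2 e' : {set delete_leaves G},
        e' \in edges_in [set: delete_leaves G] & e = val @: e'.
    case/edges_inP=> x [y [xy /lift[x' ex] /lift[y' ey] ->]].
    rewrite ex ey in xy *; exists [set x'; y']; last by rewrite imsetU1 imset_set1.
    by apply/edges_inP; exists x', y'; rewrite !in_setT.
  move=> e e' /lifte[e1 e1S ->] /lifte[e2 e2S ->]; rewrite !fvale => ce.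
  by rewrite (rbf0 _ _ e1S e2S ce).
have /eqP/cards1P[u0 u0E] : vdegree v = 1.
  by apply/eqP; rewrite -/(leaf v); apply: contraR vS => lv; apply: (subsetP S0S); rewrite inE.
have adjv u : adj u v -> u = u0.
  by move=> uv; apply/set1P; rewrite -u0E inE adj_sym.
pose B := \bigcup_(i in used_colors c S g) color_nbhd (g u0) i.
have ltS : #|S| < #|G|.
  by apply: leq_ltn_trans (_ : #|[set~ v]| < _);
     [apply/subset_leq_card/subsetP => x xS; rewrite !inE; apply: contraNneq vS => <-
     |rewrite cardsC1 ltn_predL; apply/card_gt0P; exists v].
have [w wU] : exists2 w, w \in U & w \notin g @: S :|: B.
  apply: exists_notin; apply: leq_trans leU.
  apply: leq_ltn_trans (leq_card_setU _ _) _.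
  rewrite -addSn leq_add ?card_bigcup_color_nbhd //.
  exact: leq_ltn_trans (leq_imset_card _ _) ltS.
rewrite in_setU negb_or => /andP[wS wB]; exists w; split; last first.
  by move=> x; case: ifP.
apply: rainbow_on_setU1 => // [u uS /adjv uu0|u u' _ _ /adjv-> /adjv->] //.
rewrite uu0 in uS *; apply: used_colorsPn => //.
by apply: contraNneq wS => ->; apply: imset_f.
Qed.


(** * Bounded color degrees: embedding a graph of bounded degree *)

Section MaxDegree.
Variables (G : sgraph) (d m : nat).
Hypothesis d_gt0 : 0 < d.
Hypothesis degG : forall x : G, vdegree x <= d.
Hypothesis leG : #|G| <= m.
Hypothesis leU : (2 * d ^ 2 * m + 32 * d ^ 4) * D + 4 * m <= #|U|.

Definition same_color (x y : T) : {set T} :=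
  [set w in U | [&& w != x, w != y & c [set x; w] == c [set y; w]]].

(* If [f u] and [f u'] form a bad pair, a common neighbor of [u] and [u'] might
   have no admissible image; the embedding avoids this in advance. *)
Definition bad_pair (x y : T) : bool := #|U| < 2 * d ^ 2 * #|same_color x y|.

Lemma bad_pairC x y : bad_pair x y = bad_pair y x.
Proof.
suff same_colorC : same_color x y = same_color y x.
  by rewrite /bad_pair same_colorC.
by apply/setP => w; rewrite !inE (andbCA (w != x)) (eq_sym (c [set x; w])).
Qed.

(** Summing over [w] first, the [y] counted for a given [w] lie in its neighborhood in color [c
    [set x; w]], of size at most [D]. *)
Lemma sum_same_color x : x \in U -> \sum_(y in U) #|same_color x y| <= #|U| * D.
Proof.
move=> xU; rewrite sum_card_mem exchange_big -sum_card_mem -sum_nat_const /=.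
apply: leq_sum => w wU; apply: leq_trans (bounded (c [set x; w]) wU).
apply/subset_leq_card/subsetP => y; rewrite !inE.
by case/andP=> -> /and3P[_ wy /eqP->]; rewrite eq_sym wy setUC eqxx.
Qed.

(** Markov's inequality: each bad [y] contributes more than [#|U| / (2 d^2)] to a sum of at most
    [#|U| * D]. *)
Lemma card_bad_pair x :
  x \in U -> #|[set y in U | bad_pair x y]| <= 2 * d ^ 2 * D.
Proof.
move=> xU; rewrite -(leq_pmul2l U_gt0) mulnCA.
apply: leq_trans (_ : 2 * d ^ 2 * \sum_(y in U) #|same_color x y| <= _);
  last by rewrite leq_mul2l sum_same_color ?orbT.
rewrite mulnC -sum_nat_const big_distrr big_mkcond [leqRHS]big_mkcond /=.
apply: leq_sum => y _; rewrite inE; case: (y \in U) => //=.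
by case: ifP => // /ltnW.
Qed.

Lemma rainbow_bounded_degree : rainbow_in c G U.
Proof.
have [x0 x0U] : exists x0, x0 \in U by apply/card_gt0P.
pose nbr (v : G) := [set u : G | adj u v].
have card_nbr v : #|nbr v| <= d.
  by apply: leq_trans (degG v); apply/subset_leq_card/subsetP => u; rewrite !inE adj_sym.
(* In the last clause [z] need not lie in [S], so pairs of neighbors are already good when [z] comes
   to be placed. *)
pose P S (f : G -> T) := [/\ rainbow_on c S f, forall x, f x \in U &
  {in S &, forall u u' z, u != u' -> adj u z -> adj u' z -> ~~ bad_pair (f u) (f u')}].
suff [g [rbg gU _]] : exists f, P [set: G] f by exists g.
apply: (greedy_extension (S0 := set0) (f0 := fun=> x0)) => [|S f v _ vS [rbf fU okf]].
  split=> //; last by move=> x y; rewrite inE.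
  by split=> [x y|e e' /edges_inP[z [? []]]]; rewrite inE.
pose N := nbr v :&: S.
have cardN : #|N| <= d.
  by apply: leq_trans (card_nbr v); rewrite subset_leq_card ?subsetIl.
(* A choice in [B1] repeats a used color, one in [B2] gives two new edges the same color, and one in
   [B3] may create a bad pair. *)
pose B1 := \bigcup_(u in N) \bigcup_(i in used_colors c S f) color_nbhd (f u) i.
pose B2 := \bigcup_(u in N) \bigcup_(u' in N :\ u) same_color (f u) (f u').
pose B3 := \bigcup_(z in nbr v) \bigcup_(u in nbr z) [set w in U | bad_pair (f u) w].
have ltS : #|S| < m.
  apply: leq_trans leG.
  by apply: leq_ltn_trans (_ : #|[set~ v]| < _);
     [apply/subset_leq_card/subsetP => x xS; rewrite !inE; apply: contraNneq vS => <-
     |rewrite cardsC1 ltn_predL; apply/card_gt0P; exists v].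
have leB1 : 1 * #|B1| <= d * (num_edges G * D).
  by apply: card_bigcup_bound => // u _; rewrite mul1n card_bigcup_color_nbhd.
(* There are at most [d^2] ordered pairs of neighbors, none of them bad, so together they block at
   most half of [U]. *)
have leB2 : 2 * d ^ 2 * #|B2| <= d * (d * #|U|).
  apply: card_bigcup_bound => // u uN; apply: card_bigcup_bound => [|u'].
    by apply: leq_trans cardN; rewrite subset_leq_card ?subsetDl.
  move: uN; rewrite !inE => /andP[uv uS] /and3P[u'u u'v u'S].
  by rewrite leqNgt; apply: (okf _ _ uS u'S v); rewrite // eq_sym.
have leB3 : 1 * #|B3| <= d * (d * (2 * d ^ 2 * D)).
  apply: card_bigcup_bound => // z _; apply: card_bigcup_bound => // u _.
  by rewrite mul1n card_bad_pair.
have leE := num_edges_degree_bound degG leG.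
have [w wU] : exists2 w, w \in U & w \notin f @: S :|: B1 :|: B2 :|: B3.
  apply: exists_notin.
  apply: leq_ltn_trans (_ : #|S| + #|B1| + #|B2| + #|B3| < _).
    do 3! [apply: leq_trans (leq_card_setU _ _) _; rewrite leq_add2r].
    exact: leq_imset_card.
  have leB2' : 2 * #|B2| <= #|U|.
    by rewrite -(@leq_pmul2l (d ^ 2)) ?expn_gt0 ?d_gt0 // mulnA [d ^ 2 * 2]mulnC -[d ^ 2 * #|U|]mulnA.
  have leB1' : 2 * #|B1| <= d ^ 2 * m * D.
    rewrite mul1n in leB1; apply: leq_trans (_ : d * (2 * num_edges G * D) <= _); first by lia.
    by rewrite -[d ^ 2]/(d * d) -!mulnA leq_mul2l !mulnA leq_mul2r leE !orbT.
  have leB3' : #|B3| <= 2 * (d ^ 4 * D) by lia.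
  (* Twice the blocked total is less than [2 m + d^2 m D + #|U| + 4 d^4 D], which is at most
     [2 #|U|]. *)
  have : 2 * (d ^ 2 * m * D) + 32 * (d ^ 4 * D) + 4 * m <= #|U| by lia.
  lia.
rewrite !in_setU !negb_or -!andbA => /and4P[wS wB1 wB2 wB3].
have fuw u : u \in S -> w != f u.
  by move=> uS; apply: contraNneq wS => ->; apply: imset_f.
have okw u z : adj u z -> adj v z -> ~~ bad_pair (f u) w.
  move=> uz vz; apply: contra wB3 => bad; apply/bigcupP; exists z.
    by rewrite inE adj_sym.
  by apply/bigcupP; exists u; rewrite inE ?wU.
exists w; split.
- apply: rainbow_on_setU1 => // [u uS uv|u u' uS u'S uv u'v ce].
    apply: used_colorsPn => //; first exact: fuw.
    by apply: contra wB1 => uB; apply/bigcupP; exists u; rewrite // !inE uv uS.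
  apply: contraNeq wB2 => uu'; apply/bigcupP; exists u; first by rewrite !inE uv uS.
  apply/bigcupP; exists u'; first by rewrite !inE eq_sym uu' u'v u'S.
  by rewrite inE wU !fuw // ce eqxx.
- by move=> x; case: ifP.
- move=> u u' uS u'S z uu' uz u'z; move: uS u'S; rewrite !in_setU1.
  case: eqVneq => [uv|uv]; case: eqVneq => [u'v|u'v] //= uS u'S.
  + by rewrite uv u'v eqxx in uu'.
  + by rewrite bad_pairC; apply: okw u'z _; rewrite -uv.
  + by apply: okw uz _; rewrite -u'v.
  + exact: okf uu' uz u'z.
Qed.

End MaxDegree.
End LocallyBounded.

(** * Recursion on the clique sizes *)

Fixpoint gr_bound (N m q : nat) : nat :=
  if q is q'.+1 then N * gr_bound N m q' + 4 * m else 1.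

Lemma gr_bound_gt0 N m q : 0 < N -> 0 < gr_bound N m q.
Proof. by move=> N_gt0; elim: q => //= q IHq; rewrite addn_gt0 muln_gt0 N_gt0 IHq. Qed.

Section Recursion.
Variables (T C : finType) (c : {set T} -> C) (G : sgraph) (N m : nat).
Hypothesis N_gt0 : 0 < N.
Hypothesis rainbow_if_bounded : forall (U : {set T}) D,
  (forall x i, x \in U -> #|color_nbhd c U x i| <= D) ->
  N * D.+1 + 4 * m <= #|U| -> rainbow_in c G U.

(** The targets vary with the color, so that passing to a neighborhood in color [i] lowers [t i]
    alone. The color [i0] labels the empty clique when [q = 0]. *)
Lemma rainbow_or_mono_clique q (t : C -> nat) (U : {set T}) (i0 : C) :
  \sum_i t i = q -> gr_bound N m q <= #|U| ->
  (exists U', rainbow_in c G U') \/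
  exists i (S : {set T}), [/\ S \subset U, #|S| = t i &
    {in S &, forall x y, x != y -> c [set x; y] = i}].
Proof.
elim: q t U => [|q IHq] t U sum_t leU.
  right; exists i0, set0; rewrite sub0set cards0; split=> // [|x y].
    by apply/esym/eqP; rewrite -leqn0 -sum_t (bigD1 i0) //= leq_addr.
  by rewrite inE.
have [/existsP[x /andP[xU /existsP[i leN]]]|noN] := boolP
    [exists x, (x \in U) && [exists i, gr_bound N m q <= #|color_nbhd c U x i|]];
  last first.
  (* With [D] one less than [gr_bound N m q], the size required of [U] is exactly
     [gr_bound N m q.+1]. *)
  left; exists U; apply: (@rainbow_if_bounded U (gr_bound N m q).-1) => [x i xU|].
    rewrite -ltnS prednK ?gr_bound_gt0 // ltnNge; apply: contra noN => leN.
    by apply/existsP; exists x; rewrite xU; apply/existsP; exists i.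
  by rewrite prednK ?gr_bound_gt0.
(* A target that is already zero cannot be lowered, but the empty clique meets it. *)
have [ti0|ti_gt0] := posnP (t i).
  right; exists i, set0; rewrite sub0set cards0 ti0; split=> // y z.
  by rewrite inE.
pose t' j := if j == i then (t i).-1 else t j.
have sum_t' : \sum_j t' j = q.
  apply: succn_inj; rewrite -sum_t (bigD1 i) // [RHS](bigD1 i) //= /t' eqxx.
  rewrite -addSn prednK //; congr (_ + _).
  by apply: eq_bigr => j /negPf->.
have subU : color_nbhd c U x i \subset U.
  by apply/subsetP => y; rewrite inE => /andP[].
case: (IHq _ _ sum_t' leN) => [|[j [S [SN cardS monoS]]]]; first by left.
right; exists j; move: cardS; rewrite /t'; case: eqP => [ji|_] cardS; last first.
  by exists S; split=> //; apply: subset_trans subU.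
have xnbr y : y \in S -> y != x /\ c [set x; y] = j.
  by move/(subsetP SN); rewrite inE ji => /and3P[_ -> /eqP].
exists (x |: S); split.
- by rewrite subUset sub1set xU (subset_trans SN subU).
- rewrite cardsU1 cardS ji; case: (boolP (x \in S)) => [/xnbr[]|_].
    by rewrite eqxx.
  by rewrite add1n prednK.
- move=> y z; rewrite !in_setU1.
  move=> /orP[/eqP->|yS] /orP[/eqP->|zS] yz.
  + by rewrite eqxx in yz.
  + by case: (xnbr _ zS).
  + by rewrite setUC; case: (xnbr _ yS).
  + exact: monoS.
Qed.

End Recursion.

(** * Copies, isomorphism invariance and deleted edges *)

Lemma mono_copy_of_clique (n k t : nat) (c : coloring n k) (i : 'I_k)
    (S : {set 'I_n}) :
  #|S| = t -> {in S &, forall x y, x != y -> c [set x; y] = i} ->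
  has_mono_copy c (complete t).
Proof.
move=> <- mono; exists (enum_val : 'I_#|S| -> 'I_n); split; first exact: enum_val_inj.
have ci (e : {set complete #|S|}) : e \in edges (complete #|S|) ->
    c (enum_val @: (e : {set 'I_#|S|})) = i.
  case/edgesP=> x [y [xy ->]]; rewrite imsetU1 imset_set1.
  by apply: mono; rewrite ?enum_valP // (inj_eq enum_val_inj).
by move=> e e' /ci-> /ci->.
Qed.

Lemma rainbow_copy_of_in (n k : nat) (c : coloring n k) (G : sgraph)
    (U : {set complete n}) :
  rainbow_in c G U -> has_rainbow_copy c G.
Proof.
case=> f [injf rbf] _; exists f; split; first by move=> x y; apply: injf.
by move=> e e' eG eG'; apply: rbf; rewrite inE subsetT andbT.
Qed.

Lemma isomorphic_hom (G H : sgraph) :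
  isomorphic G H ->
  exists h : G -> H, injective h /\ forall x y, adj x y -> adj (h x) (h y).
Proof.
case=> f [bijf adjf]; exists f; split; first exact: bij_inj.
by move=> x y; rewrite adjf.
Qed.

Lemma isomorphic_sym (G H : sgraph) : isomorphic G H -> isomorphic H G.
Proof.
case=> f [[g fK gK] adjf]; exists g; split; first by exists f.
by move=> x y; rewrite -adjf !gK.
Qed.

Lemma num_edges_hom (G H : sgraph) (h : G -> H) :
  injective h -> (forall x y, adj x y -> adj (h x) (h y)) ->
  num_edges G <= num_edges H.
Proof.
move=> injh homh.
rewrite /num_edges -(card_imset (edges G) (imset_inj injh)).
apply/subset_leq_card/subsetP.
move=> _ /imsetP[_ /edgesP[x [y [xy ->]]] ->].
by rewrite imsetU1 imset_set1 adj_edges ?homh.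
Qed.

Lemma isomorphic_num_edges (G H : sgraph) :
  isomorphic G H -> num_edges G = num_edges H.
Proof.
move=> isoGH; apply/eqP; rewrite eqn_leq.
have [h [injh homh]] := isomorphic_hom isoGH.
have [h' [injh' homh']] := isomorphic_hom (isomorphic_sym isoGH).
by rewrite (num_edges_hom injh homh) (num_edges_hom injh' homh').
Qed.

Lemma isomorphic_order (G H : sgraph) : isomorphic G H -> #|G| = #|H|.
Proof. by case=> f [bijf _]; apply: bij_eq_card bijf. Qed.

(** A deleted edge is the closed neighborhood of any leaf on it, so leaves map onto deleted edges.
    An isolated edge comes from two leaves. *)
Lemma card_deleted_edges_le (G : sgraph) :
  #|deleted_edges G| <= #|[set x : G | leaf x]|.
Proof.
apply: leq_trans (leq_imset_card (fun x : G => x |: [set y | adj x y]) _).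
apply/subset_leq_card/subsetP => e; rewrite inE => /andP[/edgesP[x [y [xy ->]]]].
have nbrE (u v : G) : adj u v -> leaf u -> [set u; v] = u |: [set z | adj u z].
  rewrite /leaf => uv /cards1P[z uE]; rewrite uE.
  have : v \in [set y | adj u y] by rewrite inE.
  by rewrite uE => /set1P->.
case/existsP=> z /andP[]; rewrite !inE => /orP[]/eqP-> lz; apply/imsetP.
  by exists x; rewrite ?inE // nbrE.
by exists y; rewrite ?inE // setUC nbrE // adj_sym.
Qed.

Lemma order_delete_leaves (G : sgraph) :
  #|delete_leaves G| + #|deleted_edges G| <= #|G|.
Proof.
rewrite card_sig -(cardsC [set x : G | leaf x]) addnC.
rewrite leq_add ?card_deleted_edges_le //.
by apply/subset_leq_card/subsetP => x; rewrite !inE.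
Qed.

(** Surviving edges contain no leaf of [G], hence are disjoint from the deleted ones. *)
Lemma num_edges_delete_leaves (G : sgraph) :
  num_edges (delete_leaves G) + #|deleted_edges G| <= num_edges G.
Proof.
have injv : injective (fun e : {set delete_leaves G} => val @: e : {set G}).
  exact: imset_inj val_inj.
rewrite /num_edges -(card_imset _ injv) -cardsUI.
have -> : (fun e : {set delete_leaves G} => val @: e : {set G})
    @: edges (delete_leaves G) :&: deleted_edges G = set0.
  apply/setP => e; rewrite !inE; apply/negP.
  case/and3P=> /imsetP[e' _ ->] _ /existsP[x /andP[/imsetP[y _ ->]]].
  by have := valP y; rewrite inE => /negPf->.
rewrite cards0 addn0; apply/subset_leq_card/subsetP => e.
rewrite inE => /orP[/imsetP[_ /edgesP[x [y [xy ->]]] ->]|].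
  by rewrite imsetU1 imset_set1 adj_edges.
by rewrite inE => /andP[].
Qed.

(** * The chain of leaf deletions *)

Section DeletionChain.
Variables (a : nat) (F : nat -> sgraph).
Hypothesis chain : forall i, 2 <= i <= a -> isomorphic (F i) (delete_leaves (F i.-1)).

(** Used with two sizes: the order gives [#|F a| <= s - r], the number of edges gives [r <= b]. *)
Lemma chain_telescope (size : sgraph -> nat) i :
  (forall G H, isomorphic G H -> size G = size H) ->
  (forall G, size (delete_leaves G) + #|deleted_edges G| <= size G) ->
  1 <= i <= a ->
  size (F i) + \sum_(1 <= j < i) #|deleted_edges (F j)| <= size (F 1).
Proof.
move=> size_iso size_del; case: i => // i; elim: i => [|i IHi] lei.
  by rewrite big_geq // addn0.
have/size_iso-> := chain (lei : 2 <= i.+2 <= a).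
rewrite big_nat_recr //= addnCA addnC.
apply: leq_trans (IHi _); last exact: ltnW.
by rewrite leq_add2r size_del.
Qed.

(** Order and number of edges never exceed those of [F 1], so one lower bound on [#|U|] serves at
    every stage. *)
Lemma rainbow_chain (T C : finType) (c : {set T} -> C) (U : {set T}) D :
  0 < a -> 0 < #|U| ->
  (forall x i, x \in U -> #|color_nbhd c U x i| <= D) ->
  #|F 1| + num_edges (F 1) * D <= #|U| ->
  rainbow_in c (F a) U -> rainbow_in c (F 1) U.
Proof.
move=> a_gt0 U_gt0 bounded leU rba.
suff rb i : i < a -> rainbow_in c (F (a - i)) U.
  have -> : 1 = a - a.-1 by lia.
  by apply: rb; rewrite prednK.
elim: i => [|i IHi] lti; first by rewrite subn0.
have le2 : 2 <= a - i <= a by lia.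
have [h [injh homh]] := isomorphic_hom (isomorphic_sym (chain le2)).
have le1 : 1 <= a - i.+1 <= a by lia.
apply: (rainbow_delete_leaves U_gt0 bounded).
  apply: leq_trans leU; rewrite leq_add //.
    apply: leq_trans (chain_telescope (size := fun G => #|G|) _ _ le1).
    - exact: leq_addr.
    - exact: isomorphic_order.
    - exact: order_delete_leaves.
  rewrite leq_mul2r; apply/orP; right.
  apply: leq_trans (chain_telescope (size := num_edges) _ _ le1).
  - exact: leq_addr.
  - exact: isomorphic_num_edges.
  - exact: num_edges_delete_leaves.
rewrite subnS; apply: rainbow_in_hom injh homh (IHi _); exact: ltnW.
Qed.

End DeletionChain.

(** * Existence of the least integer, closed form and conclusion *)

(** Excluded middle decides whether a smaller witness exists, as [P] is an arbitrary proposition. *)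
Lemma exists_least (P : nat -> Prop) n0 :
  P n0 -> exists n, (P n /\ forall m, P m -> n <= m) /\ n <= n0.
Proof.
have [k] := ubnP n0; elim: k n0 => // k IHk n0 ltn0 Pn0.
have [[n [Pn ltn]]|none] := classic (exists n, P n /\ n < n0).
  have [n' [leastn' len']] := IHk n (leq_trans ltn ltn0) Pn.
  by exists n'; split=> //; apply: leq_trans len' (ltnW ltn).
exists n0; split=> //; split=> // n Pn; rewrite leqNgt; apply/negP => ltn.
by apply: none; exists n.
Qed.

Import Order.TTheory GRing.Theory Num.Theory.
Local Open Scope ring_scope.

Lemma gr_bound_closed_form (N m q : nat) :
  (1 < N)%N ->
  (gr_bound N m q)%:R = N%:R ^+ q + 4 * m%:R * ((N%:R ^+ q - 1) / (N%:R - 1)) :> rat.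
Proof.
move=> N_gt1.
have N1 : (N%:R - 1 : rat) != 0 by rewrite subr_eq0 (eqr_nat _ N 1) gtn_eqF.
elim: q => [|q IHq] /=; first by rewrite expr0 subrr mul0r mulr0 addr0.
by rewrite natrD !natrM IHq exprS; field.
Qed.

Theorem theorem1p14 (s t k a r d b : nat) (F : nat -> sgraph)
  (hk : (0 < k)%N)
  (hs : graph_order (F 1%N) = s)
  (ha : (1 <= a)%N)
  (hF : forall i : nat, (2 <= i <= a)%N ->
          isomorphic (F i) (delete_leaves (F i.-1)))
  (hFa : forall x : F a, ~~ leaf x)
  (hr : r = (\sum_(1 <= i < a) #|deleted_edges (F i)|)%N)
  (hd : max_degree (F a) = d)
  (hd2 : (2 <= d)%N)
  (hb : num_edges (F 1%N) = b)
  (hbN : (b%:R : rat) <= 2 * d%:R ^+ 2 * (s%:R - r%:R) + 32 * d%:R ^+ 4) :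
  exists n : nat,
    is_gallai_ramsey k (F 1%N) (complete t) n /\
    (n%:R : rat) <=
      (2 * d%:R ^+ 2 * (s%:R - r%:R) + 32 * d%:R ^+ 4) ^+ (k * t) +
      4 * (s%:R - r%:R) *
        (((2 * d%:R ^+ 2 * (s%:R - r%:R) + 32 * d%:R ^+ 4) ^+ (k * t) - 1) /
         (2 * d%:R ^+ 2 * (s%:R - r%:R) + 32 * d%:R ^+ 4 - 1)).
Proof.
have lea : (1 <= a <= a)%N by rewrite ha leqnn.
have := chain_telescope hF (size := fun G => #|G|) isomorphic_order order_delete_leaves lea.
have := chain_telescope hF isomorphic_num_edges num_edges_delete_leaves lea.
rewrite -hr hb => le_rb; rewrite [#|F 1%N|]hs => le_rs.
have {le_rs} [le_rs leFa] : (r <= s /\ #|F a| <= s - r)%N by lia.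
pose m := (s - r)%N; pose N := (2 * d ^ 2 * m + 32 * d ^ 4)%N.
(* Since [r <= s], truncated and rational subtraction agree. *)
have mE : s%:R - r%:R = m%:R :> rat by rewrite natrB.
have NE : 2 * d%:R ^+ 2 * m%:R + 32 * d%:R ^+ 4 = N%:R :> rat.
  by rewrite -!natrX -!natrM -natrD.
rewrite mE NE in hbN *; rewrite ler_nat in hbN.
have N_gt1 : (1 < N)%N.
  have : (0 < d ^ 4)%N by rewrite expn_gt0 (ltnW hd2).
  by rewrite /N; lia.
rewrite -gr_bound_closed_form //.
suff [n [leastn len]] : exists n, is_gallai_ramsey k (F 1%N) (complete t) n
    /\ (n <= gr_bound N m (k * t))%N by exists n; rewrite ler_nat.
apply: exists_least => c.
have rainbow (U : {set complete (gr_bound N m (k * t))}) D :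
    (forall x i, x \in U -> (#|color_nbhd c U x i| <= D)%N) ->
    (N * D.+1 + 4 * m <= #|U|)%N -> rainbow_in c (F 1%N) U.
  move=> bounded leU; have U_gt0 : (0 < #|U|)%N by lia.
  apply: (rainbow_chain hF ha U_gt0 bounded).
    (* Here [s = m + r] and [r <= b <= N], so the extra [N] in [N * D.+1] pays for the [r] vertices
       beyond [m]. *)
    rewrite [#|F 1%N|]hs hb; apply: leq_trans leU.
    have : (b * D <= N * D)%N by rewrite leq_mul2r hbN orbT.
    by rewrite /m in leFa *; lia.
  apply: (rainbow_bounded_degree (d := d) (m := m) U_gt0 bounded) => //.
  - exact: ltnW.
  - by move=> x; rewrite -hd; apply: (leq_bigmax x).
  - by rewrite -/N; lia.
(* Every color gets the target [t], and the targets add up to [k * t]. *)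
have [||[U rbU]|[i [S [_ cardS monoS]]]] :=
  rainbow_or_mono_clique (ltnW N_gt1) rainbow (q := k * t) (t := fun=> t)
    (U := [set: complete _]) (Ordinal hk).
- by rewrite sum_nat_const card_ord.
- by rewrite cardsT card_ord.
- by left; apply: rainbow_copy_of_in rbU.
- by right; apply: mono_copy_of_clique cardS monoS.
Qed.
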